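(* Let $p\in\{4,5\}$ and let $m\geq 1$ be an integer. Then there is a constant $c(p,m)>0$, depending only on $p$ and $m$, such that for all distinct $x_1,\dots,x_p\in\mathbb R^m$ and all $(u_1,\dots,u_p)\in\mathbb R^p$, $$\sum_{1\leq i\leq p}\Big|\sum_{j\neq i}\frac{u_j}{|x_i-x_j|}\Big|^2+2\sup_{1\leq i\leq p}\Big|\sum_{j\neq i}u_i\frac{x_i-x_j}{|x_i-x_j|^3}u_j\Big|\;\geq\; c(p,m)\sum_{\substack{1\leq i,j\leq p\\ j\neq i}}\frac{u_j^2}{|x_i-x_j|^2}.$$
   Context: This is the Bahri–Xu inequality for $p=4,5$ points in $\mathbb R^m$. $|\cdot|$ is the Euclidean norm (of a scalar or a vector in $\mathbb R^m$). Inner sums $\sum_{j\neq i}$ run over $1\leq j\leq p$, $j\neq i$. *)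

(* Defs.v *)
From HB Require Import structures.
From mathcomp Require Import all_boot all_order all_algebra.
From mathcomp Require Import reals.

Set Implicit Arguments.
Unset Strict Implicit.
Unset Printing Implicit Defensive.

Import Order.TTheory GRing.Theory Num.Theory.
Local Open Scope ring_scope.

(* Euclidean norm on R^m; the canonical norm on row vectors in
   MathComp-Analysis is the sup norm, hence this definition. *)
Definition enorm (R : realType) (m : nat) (v : 'rV[R]_m) : R :=
  Num.sqrt (\sum_(k < m) v 0 k ^+ 2).

(* Main.v *)
Require Import Defs.
From HB Require Import structures.
From mathcomp Require Import all_boot all_order all_algebra.
From mathcomp Require Import reals.
From mathcomp Require Import ring lra.
From mathcomp Require Import interval_inference boolp classical_sets functions.
From mathcomp Require Import filter topology normedtype realfun sequences.

(** Rescale so that the largest |u_j| / |x_i - x_j| is 1 and suppose that, along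
    some sequence, all potentials V_i = sum_j u_j / |x_i - x_j| and all forces
    F_i tend to 0. Take limits along an ultrafilter. Among the j for which some
    u_j / |x_i - x_j| does not vanish in the limit, let j minimise |u_j|; after
    rescaling by |u_j| and centering at x_j, the points staying at bounded
    distance converge to a limit configuration. Points that collide there carry
    no charge, by minimality, and far points only contribute one common constant
    to the potentials. So at most five charged points are in equilibrium with
    equal potentials P, and P = 0 if no point has escaped.

    Such a configuration cannot exist. An inversion centred at one of the points
    turns five points with P = 0 into four points in equilibrium. Four collinear
    charges are never in equilibrium (a Pfaffian does not vanish). For three, or
    for four non-collinear points, the stress matrix q_i q_j / |x_i - x_j|^3 has
    rank one, so that |x_i - x_j| = rho_i rho_j and q_i = la_i rho_i^3 with
    sum la_i = 0 and sum la_i x_i = 0. Then sum_j la_j |x_i - x_j|^2 is a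
    constant C independent of i, whence C = P rho_i^3, which forces la = 0. *)

Set Implicit Arguments.
Unset Strict Implicit.
Unset Printing Implicit Defensive.

Import Order.TTheory GRing.Theory Num.Theory.
Local Open Scope ring_scope.

(** * Euclidean inner product and norm *)

Definition dot (R : realType) (m : nat) (v w : 'rV[R]_m) : R :=
  \sum_(k < m) v 0 k * w 0 k.

Section Euclidean.
Variables (R : realType) (m : nat).
Implicit Types v w : 'rV[R]_m.

Lemma dotC v w : dot v w = dot w v.
Proof. by apply: eq_bigr => k _; rewrite mulrC. Qed.

Lemma dotDl v w z : dot (v + w) z = dot v z + dot w z.
Proof. by rewrite -big_split /=; apply: eq_bigr => k _; rewrite !mxE mulrDl. Qed.

Lemma dotZl a v w : dot (a *: v) w = a * dot v w.
Proof. by rewrite mulr_sumr; apply: eq_bigr => k _; rewrite !mxE mulrA. Qed.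

Lemma dotNl v w : dot (- v) w = - dot v w.
Proof. by rewrite -scaleN1r dotZl mulN1r. Qed.

Lemma dotBl v w z : dot (v - w) z = dot v z - dot w z.
Proof. by rewrite dotDl dotNl. Qed.

Lemma dot0l v : dot 0 v = 0.
Proof. by rewrite -(scale0r 0) dotZl mul0r. Qed.

Lemma dot_suml (I : finType) (F : I -> 'rV[R]_m) w :
  dot (\sum_i F i) w = \sum_i dot (F i) w.
Proof. by elim/big_rec2: _ => [|i a v _ <-]; rewrite ?dot0l ?dotDl. Qed.

Lemma dot_ge0 v : 0 <= dot v v.
Proof. by apply: sumr_ge0 => k _; rewrite -expr2 sqr_ge0. Qed.

Lemma dot_eq0 v : (dot v v == 0) = (v == 0).
Proof.
apply/eqP/eqP => [/eqP|->]; last exact: dot0l.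
rewrite psumr_eq0 => [/allP h|k _]; last by rewrite -expr2 sqr_ge0.
apply/rowP => k; rewrite mxE; apply/eqP.
by have := h k (mem_index_enum _); rewrite /= -expr2 sqrf_eq0.
Qed.

Lemma enorm_ge0 v : 0 <= enorm v.
Proof. exact: sqrtr_ge0. Qed.

Lemma sqr_enorm v : enorm v ^+ 2 = dot v v.
Proof.
have -> : enorm v = Num.sqrt (dot v v).
  by congr Num.sqrt; apply: eq_bigr => k _; rewrite expr2.
exact: sqr_sqrtr (dot_ge0 v).
Qed.

Lemma enorm_eq0 v : (enorm v == 0) = (v == 0).
Proof. by rewrite -dot_eq0 -sqr_enorm sqrf_eq0. Qed.

Lemma enorm0 : enorm (0 : 'rV[R]_m) = 0.
Proof. by apply/eqP; rewrite enorm_eq0. Qed.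

Lemma enorm_gt0 v : (0 < enorm v) = (v != 0).
Proof. by rewrite lt_def enorm_ge0 andbT enorm_eq0. Qed.

Lemma enormZ a v : enorm (a *: v) = `|a| * enorm v.
Proof.
apply/eqP; rewrite -(eqrXn2 (n := 2)) ?mulr_ge0 ?enorm_ge0 //.
by rewrite exprMn !sqr_enorm dotZl dotC dotZl real_normK ?num_real // expr2 mulrA.
Qed.

Lemma enormB v w : enorm (v - w) = enorm (w - v).
Proof. by rewrite -opprB -scaleN1r enormZ normrN1 mul1r. Qed.

Lemma cauchy_schwarz v w : dot v w ^+ 2 <= dot v v * dot w w.
Proof.
have [->|w0] := eqVneq w 0; first by rewrite dotC !dot0l expr0n mulr0.
have ww : 0 < dot w w by rewrite lt_def dot_ge0 andbT dot_eq0.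
have := dot_ge0 (dot w w *: v - dot v w *: w).
rewrite dotBl !dotZl ![dot _ (_ - _)]dotC !dotBl !dotZl (dotC w v) => h.
rewrite -subr_ge0 -(pmulr_rge0 _ ww).
by apply: le_trans h _; rewrite le_eqVlt; apply/orP; left; apply/eqP; ring.
Qed.

Lemma ler_enormD v w : enorm (v + w) <= enorm v + enorm w.
Proof.
rewrite -(ler_pXn2r (n := 2)) ?nnegrE ?addr_ge0 ?enorm_ge0 //.
rewrite sqrrD !sqr_enorm dotDl ![dot _ (v + w)]dotC !dotDl (dotC w v).
suff : dot v w <= enorm v * enorm w by lra.
apply: le_trans (ler_norm _) _.
rewrite -(ler_pXn2r (n := 2)) ?nnegrE ?mulr_ge0 ?enorm_ge0 //.
by rewrite exprMn !sqr_enorm real_normK ?num_real // cauchy_schwarz.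
Qed.

Lemma ler_coord_enorm v k : `|v 0 k| <= enorm v.
Proof.
rewrite -(ler_pXn2r (n := 2)) ?nnegrE ?enorm_ge0 // real_normK ?num_real // sqr_enorm.
rewrite /dot (bigD1 k) //= -expr2 lerDl.
by apply: sumr_ge0 => j _; rewrite -expr2 sqr_ge0.
Qed.

Lemma sqr_enormB v w : enorm (v - w) ^+ 2 = dot v v - 2 * dot v w + dot w w.
Proof. rewrite sqr_enorm !dotBl ![dot _ (_ - _)]dotC !dotBl (dotC w v); ring. Qed.

End Euclidean.

(** * Point charges whose distances factor as products *)

Section Static.
Variables (R : realType) (m : nat).

(* Junk value: the diagonal terms of the full sums vanish since [x / 0 = 0]. *)
Definition potential n (x : 'I_n -> 'rV[R]_m) (q : 'I_n -> R) (i : 'I_n) : R :=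
  \sum_j q j / enorm (x i - x j).

Definition field n (x : 'I_n -> 'rV[R]_m) (q : 'I_n -> R) (i : 'I_n) : 'rV_m :=
  \sum_j (q j / enorm (x i - x j) ^+ 3) *: (x i - x j).

(** Multiplying the potential at [x i] by [rho i] gives [B - la i * rho i ^+ 2 = P * rho i].
    Expanding the squared distances, the two vanishing moments of [la] leave
    [rho i ^+ 2 * (B - la i * rho i ^+ 2) = C]. *)
Lemma rank_one_stress n (x : 'I_n.+2 -> 'rV[R]_m) (rho la : 'I_n.+2 -> R) P :
  (forall i, 0 < rho i) ->
  (forall i j, i != j -> enorm (x i - x j) = rho i * rho j) ->
  \sum_i la i = 0 -> \sum_i la i *: x i = 0 ->
  (forall i, potential x (fun j => la j * rho j ^+ 3) i = P) ->
  forall i, la i = 0.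
Proof.
move=> rho0 rE la0 lax VP.
have rho_neq0 i : rho i != 0 by rewrite gt_eqF.
set C := \sum_j la j * dot (x j) (x j).
set B := \sum_j la j * rho j ^+ 2.
have BV i : B - la i * rho i ^+ 2 = P * rho i.
  rewrite -(VP i) /potential /B (bigD1 i) //= [in RHS](bigD1 i) //=.
  rewrite subrr enorm0 invr0 mulr0 add0r addrAC subrr add0r mulr_suml.
  by apply: eq_bigr => j ji; rewrite rE 1?eq_sym //; field; rewrite !rho_neq0.
have BC i : rho i ^+ 2 * (B - la i * rho i ^+ 2) = C.
  transitivity (\sum_j la j * enorm (x i - x j) ^+ 2).
    rewrite /B (bigD1 i) //= [in RHS](bigD1 i) //= subrr enorm0 expr0n mulr0 add0r.
    rewrite addrAC subrr add0r mulr_sumr.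
    by apply: eq_bigr => j ji; rewrite rE 1?eq_sym //; ring.
  have -> : C = (\sum_j la j) * dot (x i) (x i)
               - 2 * dot (\sum_j la j *: x j) (x i) + C.
    by rewrite la0 lax dot0l mul0r mulr0 subr0 add0r.
  rewrite dot_suml mulr_suml mulr_sumr -sumrB -big_split /=.
  by apply: eq_bigr => j _; rewrite sqr_enormB dotZl (dotC (x j)); ring.
(* If [P = 0], every [la i * rho i ^+ 2] equals their sum [B], so [B = 0] because there are at least
   two points. Otherwise [P * rho i ^+ 3 = C] makes [rho] constant, and all [la i] are equal with
   sum zero. *)
have [P0|P0] := eqVneq P 0.
  have laB i : la i * rho i ^+ 2 = B.
    by apply/esym/eqP; rewrite -subr_eq0 BV P0 mul0r.
  have /eqP : B *+ n.+1 = 0.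
    apply: (addrI B); rewrite -mulrS addr0 {2}/B.
    by rewrite (eq_bigr (fun=> B)) // sumr_const card_ord.
  rewrite -mulr_natr mulf_eq0 pnatr_eq0 orbF => /eqP B0 i.
  have /eqP := laB i.
  by rewrite B0 mulf_eq0 expf_eq0 (negPf (rho_neq0 i)) orbF => /eqP.
have rhoE i : rho i = rho ord0.
  apply/eqP; rewrite -(eqrXn2 (n := 3)) ?ltW //; apply/eqP/(mulfI P0).
  have E j : P * rho j ^+ 3 = C by rewrite -(BC j) BV; ring.
  by rewrite !E.
set r := rho ord0 in rhoE.
have B0 : B = 0.
  rewrite /B (eq_bigr (fun j => la j * r ^+ 2)) => [|j _]; last by rewrite rhoE.
  by rewrite -mulr_suml la0 mul0r.
have laC i : la i * r ^+ 4 = - C by rewrite -(BC i) B0 rhoE; ring.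
have C0 : C = 0.
  have : \sum_(i < n.+2) la i * r ^+ 4 = - C *+ n.+2.
    by rewrite (eq_bigr (fun=> - C)) // sumr_const card_ord.
  rewrite -mulr_suml la0 mul0r => /esym/eqP.
  by rewrite -mulr_natr mulf_eq0 oppr_eq0 pnatr_eq0 orbF => /eqP.
move=> i; have /eqP := laC i.
by rewrite C0 oppr0 mulf_eq0 expf_eq0 (negPf (rho_neq0 _)) orbF => /eqP.
Qed.

(** * The stress matrix of an equilibrium *)

Definition weight n (x : 'I_n -> 'rV[R]_m) (q : 'I_n -> R) (i j : 'I_n) : R :=
  q i * q j / enorm (x i - x j) ^+ 3.

(* Each row annihilates both the constant vector and x (see [stress_row]). *)
Definition stress n (x : 'I_n -> 'rV[R]_m) (q : 'I_n -> R) (i j : 'I_n) : R :=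
  (i == j)%:R * (\sum_k weight x q i k) - weight x q i j.

Lemma weight_diag n (x : 'I_n -> 'rV[R]_m) q i : weight x q i i = 0.
Proof. by rewrite /weight subrr enorm0 expr0n invr0 mulr0. Qed.

Lemma scale_field n (x : 'I_n -> 'rV[R]_m) q i :
  q i *: field x q i = \sum_j weight x q i j *: (x i - x j).
Proof.
by rewrite scaler_sumr; apply: eq_bigr => j _; rewrite scalerA mulrA.
Qed.

(** Rows of [stress] sum to zero, so the base point [x d] cancels and the force on the charge [i]
    remains. The choice of [d] removes one column from the relation. *)
Lemma stress_row n (x : 'I_n -> 'rV[R]_m) q i d :
  field x q i = 0 -> \sum_j stress x q i j *: (x j - x d) = 0.
Proof.
move=> F0.
transitivity (q i *: field x q i); last by rewrite F0 scaler0.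
rewrite scale_field /stress.
under eq_bigr do rewrite scalerBl.
rewrite sumrB (bigD1 i) //= eqxx mul1r [X in _ + X - _]big1; last first.
  by move=> j ji; rewrite eq_sym (negPf ji) mul0r scale0r.
rewrite addr0 scaler_suml -sumrB; apply: eq_bigr => j _.
by rewrite -scalerBr opprB addrA subrK.
Qed.

(** Cramer's rule. Applied to two rows of [stress], it turns a nonzero minor into collinearity of
    the points. *)
Lemma minor_elim (X Y Z : 'rV[R]_m) (a1 a2 a3 b1 b2 b3 : R) :
  a1 *: X + a2 *: Y + a3 *: Z = 0 -> b1 *: X + b2 *: Y + b3 *: Z = 0 ->
  a1 * b2 != a2 * b1 ->
  exists s t, X = s *: Z /\ Y = t *: Z.
Proof.
move=> ha hb; rewrite -subr_eq0 => D0.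
exists ((a2 * b3 - a3 * b2) / (a1 * b2 - a2 * b1)),
       ((a3 * b1 - a1 * b3) / (a1 * b2 - a2 * b1)).
have key k : a1 * X 0 k + a2 * Y 0 k + a3 * Z 0 k = 0 /\
             b1 * X 0 k + b2 * Y 0 k + b3 * Z 0 k = 0.
  by split; [move/rowP/(_ k): ha | move/rowP/(_ k): hb]; rewrite !mxE.
split; apply/rowP => k; have [hak hbk] := key k; rewrite !mxE; apply: (mulfI D0);
  apply/eqP; rewrite -subr_eq0.
- rewrite -[X in _ == X](_ : b2 * (a1 * X 0 k + a2 * Y 0 k + a3 * Z 0 k)
     - a2 * (b1 * X 0 k + b2 * Y 0 k + b3 * Z 0 k) = 0); first by apply/eqP; field.
  by rewrite hak hbk !mulr0 subrr.
- rewrite -[X in _ == X](_ : a1 * (b1 * X 0 k + b2 * Y 0 k + b3 * Z 0 k)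
     - b1 * (a1 * X 0 k + a2 * Y 0 k + a3 * Z 0 k) = 0); first by apply/eqP; field.
  by rewrite hak hbk !mulr0 subrr.
Qed.

(** * Three and four charges in equilibrium *)

Section Small.
Variable n : nat.
Let o1 : 'I_n.+3 := lift ord0 ord0.
Let o2 : 'I_n.+3 := lift ord0 (lift ord0 ord0).

(** The distance condition lets [enorm (x i - x j)] factor as [rho i * rho j]. The last minor
    contains a diagonal entry of [stress] and yields the vanishing of the sum of the [la i]. *)
Lemma rank_one_equilibrium (x : 'I_n.+3 -> 'rV[R]_m) q P :
  injective x -> (forall i, q i != 0) ->
  (forall i, field x q i = 0) -> (forall i, potential x q i = P) ->
  (forall i j, i != ord0 -> j != ord0 -> i != j ->
     enorm (x ord0 - x i) * enorm (x ord0 - x j) * enorm (x o1 - x o2) =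
     enorm (x ord0 - x o1) * enorm (x ord0 - x o2) * enorm (x i - x j)) ->
  stress x q ord0 ord0 * stress x q o1 o2 =
  stress x q ord0 o2 * stress x q o1 ord0 -> False.
Proof.
move=> xI q0 F0 VP rE minor.
pose r i j := enorm (x i - x j).
have r0 i j : i != j -> 0 < r i j.
  by move=> ij; rewrite enorm_gt0 subr_eq0; apply: contra_neq ij => /xI.
(* The value forced on [rho ord0], since its square is the product of the distances from [x ord0] to
   [x o1] and [x o2], divided by the third distance. *)
pose s := Num.sqrt (r ord0 o1 * r ord0 o2 / r o1 o2).
have s0 : 0 < s by rewrite sqrtr_gt0 divr_gt0 ?mulr_gt0 ?r0.
have s2 : s ^+ 2 = r ord0 o1 * r ord0 o2 / r o1 o2.
  by rewrite sqr_sqrtr // divr_ge0 ?mulr_ge0 ?enorm_ge0.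
pose rho i := if i == ord0 then s else r ord0 i / s.
have rho0 i : 0 < rho i.
  by rewrite /rho; case: eqVneq => // i0; rewrite divr_gt0 ?r0 // eq_sym.
have rho_neq0 i : rho i != 0 by rewrite gt_eqF.
have rhoE i j : i != j -> r i j = rho i * rho j.
  move=> ij; rewrite /rho.
  case: (eqVneq i ord0) ij => [->|i0]; case: (eqVneq j ord0) => [->|j0] //= ij.
  - by rewrite mulrCA divff ?mulr1 // gt_eqF.
  - by rewrite divfK ?gt_eqF // /r enormB.
  - rewrite mulf_div -expr2 s2.
    have := rE i j i0 j0 ij; rewrite -!/(r _ _) => E.
    have h1 : r ord0 o1 != 0 by rewrite gt_eqF ?r0.
    have h2 : r ord0 o2 != 0 by rewrite gt_eqF ?r0.
    have h3 : r o1 o2 != 0 by rewrite gt_eqF ?r0.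
    apply: (mulfI (mulf_neq0 h1 h2)); rewrite -E; field.
    by rewrite h1 h2 h3.
pose la i := q i / rho i ^+ 3.
have la_neq0 i : la i != 0 by rewrite mulf_neq0 ?invr_eq0 ?expf_neq0.
have wE i j : i != j -> weight x q i j = la i * la j.
  by move=> ij; rewrite /weight -/(r i j) rhoE // /la; field; rewrite !rho_neq0.
(* The diagonal entry is [la ord0] times the sum of the other [la i]; cancelling
   [la ord0 * la o1 * la o2] in the minor shows that this sum is [- la ord0]. *)
have la_sum : \sum_i la i = 0.
  move: minor; rewrite /stress eqxx weight_diag !mul1r subr0.
  rewrite (_ : (ord0 == o2) = false) // (_ : (o1 == ord0) = false) //.
  rewrite (_ : (o1 == o2) = false) // !mul0r !sub0r (wE o1) // (wE ord0) // (wE o1 ord0) //.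
  rewrite (bigD1 ord0) //= weight_diag add0r.
  under eq_bigr => j j0 do rewrite wE 1?eq_sym //.
  rewrite -mulr_sumr => E; rewrite (bigD1 ord0) //=.
  apply/eqP; rewrite addrC addr_eq0; apply/eqP.
  apply: (mulIf (mulf_neq0 (mulf_neq0 (la_neq0 ord0) (la_neq0 o1)) (la_neq0 o2))).
  apply: oppr_inj; rewrite -[RHS]mulNr opprK.
  transitivity (la ord0 * (\sum_(i | i != ord0) la i) * - (la o1 * la o2)); first by ring.
  by rewrite E; ring.
(* Equilibrium of the charge [ord0] alone gives this, as [la_sum] removes [x ord0]. *)
have lax : \sum_i la i *: x i = 0.
  have E : \sum_j (la ord0 * la j) *: (x ord0 - x j) = 0.
    transitivity (q ord0 *: field x q ord0); last by rewrite F0 scaler0.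
    rewrite scale_field; apply: eq_bigr => j _.
    by have [<-|j0] := eqVneq ord0 j; rewrite ?subrr ?scaler0 // wE.
  have : la ord0 *: \sum_j la j *: x j = 0.
    rewrite scaler_sumr -[RHS]oppr0 -[in RHS]E -sumrN.
    rewrite -[LHS]addr0 -[X in _ + X](scale0r (x ord0)) -[X in X *: _](mulr0 (la ord0)).
    rewrite -[X in _ * X]oppr0 -[X in - X]la_sum mulrN mulr_sumr scaleNr scaler_suml -sumrB.
    by apply: eq_bigr => j _; rewrite scalerBr opprB scalerA.
  by move/eqP; rewrite scaler_eq0 (negPf (la_neq0 _)) => /eqP.
have := @rank_one_stress _ x rho la P rho0 rhoE la_sum lax.
have V i : potential x (fun j => la j * rho j ^+ 3) i = P.
  rewrite -(VP i); apply: eq_bigr => j _.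
  by rewrite /la divfK ?expf_neq0.
by move=> /(_ V ord0) /eqP; rewrite (negPf (la_neq0 _)).
Qed.

End Small.

(** For three points the distance condition is an identity. With base point [x o1] only two
    differences are left, so a nonzero minor would make [x ord0] and [x o1] coincide. *)
Lemma no_equilibrium3 (x : 'I_3 -> 'rV[R]_m) q P :
  injective x -> (forall i, q i != 0) ->
  (forall i, field x q i = 0) -> (forall i, potential x q i = P) -> False.
Proof.
move=> xI q0 F0 VP; apply: (rank_one_equilibrium xI q0 F0 VP).
  have ord3 (i : 'I_3) : [\/ i = ord0, i = lift ord0 ord0 | i = lift ord0 (lift ord0 ord0)].
    by case: i => [[|[|[|]]] // hi]; [constructor 1|constructor 2|constructor 3]; apply: val_inj.
  move=> i j; case: (ord3 i) => ->; case: (ord3 j) => -> // _ _ _.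
  by rewrite (enormB (x (lift ord0 (lift ord0 ord0))) (x (lift ord0 ord0))); ring.
apply/eqP; apply: contraT => D0.
set o1 := lift ord0 ord0 in D0; set o2 := lift _ _ in D0.
have row i : stress x q i ord0 *: (x ord0 - x o1) + stress x q i o2 *: (x o2 - x o1)
    + 0 *: 0 = 0.
  have := stress_row o1 (F0 i); rewrite !big_ord_recl big_ord0 subrr.
  by rewrite !scaler0 add0r !addr0.
have [s [t [E _]]] := minor_elim (row ord0) (row o1) D0.
by move/eqP: E; rewrite scaler0 subr_eq0 => /eqP/xI.
Qed.

(* The equilibrium matrix of four collinear points is antisymmetric with entries
   f (t_i - t_j), where f z = z / |z|^3 is multiplicative. As the products A, B, C of
   opposite differences satisfy A + C = B, its Pfaffian is f A - f (A + C) + f C. *)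
Lemma inverse_square_not_additive (a b : R) : a != 0 -> b != 0 -> a + b != 0 ->
  a / `|a| ^+ 3 + b / `|b| ^+ 3 != (a + b) / `|a + b| ^+ 3.
Proof.
pose f (z : R) := z / `|z| ^+ 3.
have fN z : f (- z) = - f z by rewrite /f normrN mulNr.
have fpos z : 0 < z -> f z = z ^- 2.
  by move=> z0; rewrite /f gtr0_norm //; field; rewrite gt_eqF.
have pos (c d : R) : 0 < c -> 0 < d -> f (c + d) < f c + f d.
  move=> c0 d0; rewrite !fpos ?addr_gt0 //.
  apply: (@le_lt_trans _ _ (c ^- 2)); last by rewrite ltrDl invr_gt0 exprn_gt0.
  by rewrite lef_pV2 ?posrE ?exprn_gt0 ?addr_gt0 // ler_pXn2r // ?nnegrE; lra.
rewrite -!/(f _) => a0 b0 ab0; apply/eqP => E.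
wlog ag : a b a0 b0 ab0 E / 0 < a.
  move=> H; case: (ltgtP 0 a) (a0) => // a1 _; first exact: (H a b).
  apply: (H (- a) (- b)); rewrite ?oppr_eq0 ?oppr_gt0 //.
    by rewrite -opprD oppr_eq0.
  by rewrite -opprD !fN -opprD E.
case: (ltgtP 0 b) b0 => // b1 _.
  by have := pos a b ag b1; rewrite E ltxx.
(* When [b] is negative, moving terms across the equation gives an additive identity between
   positive arguments, again excluded by [pos]. *)
case: (ltgtP 0 (a + b)) ab0 => // s1 _.
  have := pos (a + b) (- b) s1; rewrite oppr_gt0 addrK fN -E addrK ltxx.
  by move/(_ b1).
have := pos (- (a + b)) a; rewrite oppr_gt0 s1 opprD addrAC addNr add0r.
rewrite -opprD !fN -E => /(_ isT ag).
by rewrite opprD addrAC addNr add0r ltxx.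
Qed.

Lemma no_equilibrium4_collinear (x : 'I_4 -> 'rV[R]_m) q (b v : 'rV[R]_m) t :
  injective x -> (forall i, q i != 0) ->
  (forall i, x i = b + t i *: v) ->
  (forall i, field x q i = 0) -> False.
Proof.
move=> xI q0 xE F0.
have tI i j : i != j -> t i - t j != 0.
  by move=> ij; rewrite subr_eq0; apply: contra_neq ij => tij; apply: xI; rewrite !xE tij.
pose o0 : 'I_4 := ord0.
pose o1 : 'I_4 := lift ord0 ord0.
pose o2 : 'I_4 := lift ord0 (lift ord0 ord0).
pose o3 : 'I_4 := lift ord0 (lift ord0 (lift ord0 ord0)).
have v0 : v != 0.
  apply/negP => /eqP v0; have /xI : x o0 = x o1 by rewrite !xE v0 !scaler0.
  by [].
pose f (z : R) := z / `|z| ^+ 3.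
have row i : \sum_j q j * f (t i - t j) = 0.
  have : (\sum_j q j * f (t i - t j)) *: (enorm v ^- 3 *: v) = 0.
    rewrite -[RHS](F0 i) scaler_suml; apply: eq_bigr => j _.
    have -> : x i - x j = (t i - t j) *: v.
      by rewrite !xE opprD addrACA subrr add0r scalerBl.
    by rewrite enormZ !scalerA /f -!exprVn invfM; congr (_ *: _); ring.
  by move/eqP; rewrite !scaler_eq0 invr_eq0 expf_eq0 enorm_eq0 (negPf v0) !orbF => /eqP.
have fN i j : f (t i - t j) = - f (t j - t i) by rewrite /f distrC -mulNr opprB.
have fM y z : f y * f z = f (y * z).
  by rewrite /f normrM -!exprVn invfM; ring.
have f0 : f 0 = 0 by rewrite /f mul0r.
move: (row o0) (row o1) (row o2); rewrite !big_ord_recl !big_ord0.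
rewrite -/o0 -/o1 -/o2 -/o3 !subrr !f0 !(fN o1 o0) !(fN o2 o0) !(fN o2 o1).
set f01 := f (t o0 - t o1); set f02 := f (t o0 - t o2); set f03 := f (t o0 - t o3).
set f12 := f (t o1 - t o2); set f13 := f (t o1 - t o3); set f23 := f (t o2 - t o3).
move=> r0 r1 r2.
have e0 : q o1 * f01 + q o2 * f02 + q o3 * f03 = 0 by rewrite -[RHS]r0; ring.
have e1 : q o2 * f12 + q o3 * f13 - q o0 * f01 = 0 by rewrite -[RHS]r1; ring.
have e2 : q o3 * f23 - q o0 * f02 - q o1 * f12 = 0 by rewrite -[RHS]r2; ring.
(* In this combination of three rows the charges at [o0], [o1], [o2] cancel, and the Pfaffian times
   the last charge remains. *)
have : (f01 * f23 - f02 * f13 + f03 * f12) * q o3 = 0.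
  transitivity (f12 * (q o1 * f01 + q o2 * f02 + q o3 * f03)
    - f02 * (q o2 * f12 + q o3 * f13 - q o0 * f01)
    + f01 * (q o3 * f23 - q o0 * f02 - q o1 * f12)); first by ring.
  by rewrite e0 e1 e2 !mulr0 subrr addr0.
move/eqP; rewrite mulf_eq0 (negPf (q0 _)) orbF !fM.
have := @inverse_square_not_additive ((t o0 - t o1) * (t o2 - t o3))
  ((t o0 - t o3) * (t o1 - t o2)).
rewrite !mulf_neq0 ?tI //.
have -> : (t o0 - t o1) * (t o2 - t o3) + (t o0 - t o3) * (t o1 - t o2)
  = (t o0 - t o2) * (t o1 - t o3) by ring.
rewrite mulf_neq0 ?tI // => /(_ isT isT isT); rewrite -!/(f _) => /negP E /eqP D; apply: E.
by rewrite -subr_eq0 -D addrAC.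
Qed.

(** Each of three minors of [stress] must vanish: a base point chosen to drop one column leaves
    three differences, and a nonzero minor would put all four points on a line. Two of the minors
    avoid the diagonal and equate the three products of opposite distances; the third is the one
    with a diagonal entry. *)
Lemma no_equilibrium4 (x : 'I_4 -> 'rV[R]_m) q P :
  injective x -> (forall i, q i != 0) ->
  (forall i, field x q i = 0) -> (forall i, potential x q i = P) -> False.
Proof.
move=> xI q0 F0 VP.
pose o0 : 'I_4 := ord0.
pose o1 : 'I_4 := lift ord0 ord0.
pose o2 : 'I_4 := lift ord0 (lift ord0 ord0).
pose o3 : 'I_4 := lift ord0 (lift ord0 (lift ord0 ord0)).
have ord4P (Q : 'I_4 -> Prop) : Q o0 -> Q o1 -> Q o2 -> Q o3 -> forall i, Q i.
  move=> Q0 Q1 Q2 Q3 [[|[|[|[|]]]] // hi].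
  - by rewrite (_ : Ordinal hi = o0) //; apply: val_inj.
  - by rewrite (_ : Ordinal hi = o1) //; apply: val_inj.
  - by rewrite (_ : Ordinal hi = o2) //; apply: val_inj.
  - by rewrite (_ : Ordinal hi = o3) //; apply: val_inj.
have line d c (s : 'I_4 -> R) : (forall i, x i - x d = s i *: (x c - x d)) -> False.
  move=> E; apply: (@no_equilibrium4_collinear x q (x d) (x c - x d) s) => // i.
  by rewrite -E addrC subrK.
pose S := stress x q.
have row i d : S i o0 *: (x o0 - x d) + S i o1 *: (x o1 - x d) +
    S i o2 *: (x o2 - x d) + S i o3 *: (x o3 - x d) = 0.
  by have := stress_row d (F0 i); rewrite !big_ord_recl big_ord0 addr0 !addrA.
have m1 : S o0 o1 * S o2 o3 = S o0 o3 * S o2 o1.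
  apply/eqP; apply: contraT => D0.
  have r i : S i o1 *: (x o1 - x o0) + S i o3 *: (x o3 - x o0) + S i o2 *: (x o2 - x o0) = 0.
    by rewrite addrAC -[RHS](row i o0) subrr scaler0 add0r.
  have [s [t [E1 E3]]] := minor_elim (r o0) (r o2) D0.
  case: (@line o0 o2 (fun i =>
    if i == o0 then 0 else if i == o1 then s else if i == o2 then 1 else t)).
  by apply: ord4P => /=; rewrite ?subrr ?scale0r ?scale1r.
have m2 : S o0 o1 * S o3 o2 = S o0 o2 * S o3 o1.
  apply/eqP; apply: contraT => D0.
  have r i : S i o1 *: (x o1 - x o0) + S i o2 *: (x o2 - x o0) + S i o3 *: (x o3 - x o0) = 0.
    by rewrite -[RHS](row i o0) subrr scaler0 add0r.
  have [s [t [E1 E3]]] := minor_elim (r o0) (r o3) D0.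
  case: (@line o0 o3 (fun i =>
    if i == o0 then 0 else if i == o1 then s else if i == o3 then 1 else t)).
  by apply: ord4P => /=; rewrite ?subrr ?scale0r ?scale1r.
have m3 : S o0 o0 * S o1 o2 = S o0 o2 * S o1 o0.
  apply/eqP; apply: contraT => D0.
  have r i : S i o0 *: (x o0 - x o1) + S i o2 *: (x o2 - x o1) + S i o3 *: (x o3 - x o1) = 0.
    by rewrite -[RHS](row i o1) subrr scaler0 addr0.
  have [s [t [E1 E3]]] := minor_elim (r o0) (r o1) D0.
  case: (@line o1 o3 (fun i =>
    if i == o1 then 0 else if i == o0 then s else if i == o3 then 1 else t)).
  by apply: ord4P => /=; rewrite ?subrr ?scale0r ?scale1r.
pose r i j := enorm (x i - x j).
have rC i j : r i j = r j i by rewrite /r enormB.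
have SE i j : i != j -> S i j = - (q i * q j / r i j ^+ 3).
  by move=> ij; rewrite /S /stress (negPf ij) mul0r sub0r.
have r0 i j : i != j -> r i j != 0.
  by move=> ij; rewrite enorm_eq0 subr_eq0; apply: contra_neq ij => /xI.
have cube (a b : R) : 0 <= a -> 0 <= b -> a ^+ 3 = b ^+ 3 -> a = b.
  by move=> a0 b0 /eqP; rewrite eqrXn2 // => /eqP.
(* When both sides of a minor carry the same product of charges, it cancels, and cube roots leave an
   identity between distances. *)
have prodE i j k l i' j' k' l' : i != j -> k != l -> i' != j' -> k' != l' ->
    q i * q j * (q k * q l) = q i' * q j' * (q k' * q l') ->
    S i j * S k l = S i' j' * S k' l' -> r i j * r k l = r i' j' * r k' l'.
  move=> ij kl ij' kl' qE; rewrite !SE // !mulrNN => E.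
  apply: cube; rewrite ?mulr_ge0 ?enorm_ge0 //.
  have Q0 : q i' * q j' * (q k' * q l') != 0 by rewrite !mulf_neq0.
  by move: E; rewrite !mulf_div qE => /(mulfI Q0)/invr_inj; rewrite !exprMn.
have E1 : r o0 o1 * r o2 o3 = r o0 o3 * r o2 o1 by apply: prodE => //; ring.
have E2 : r o0 o1 * r o3 o2 = r o0 o2 * r o3 o1 by apply: prodE => //; ring.
apply: (rank_one_equilibrium xI q0 F0 VP) m3 => i j.
rewrite -![enorm _]/(r _ _) -/o0 -/o1 -/o2.
rewrite (rC o3 o2) (rC o3 o1) in E2; rewrite (rC o2 o1) in E1.
elim/ord4P: i; elim/ord4P: j => // _ _ _.
all: rewrite ?(rC o2 o1) ?(rC o3 o1) ?(rC o3 o2).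
all: first [by ring
  | by transitivity (r o0 o1 * (r o0 o3 * r o1 o2)); [ring | rewrite -E1 E2; ring]
  | by transitivity (r o0 o2 * (r o0 o3 * r o1 o2)); [ring | rewrite -E1; ring]].
Qed.

(** * Inversion, and the reduction of five charges to four *)

Definition inversion (v : 'rV[R]_m) : 'rV_m := enorm v ^- 2 *: v.

Lemma enorm_inversion (v w : 'rV[R]_m) : v != 0 -> w != 0 ->
  enorm (inversion v - inversion w) = enorm (v - w) / (enorm v * enorm w).
Proof.
rewrite -2!enorm_eq0 => v0 w0.
apply/eqP; rewrite -(eqrXn2 (n := 2)) ?divr_ge0 ?mulr_ge0 ?enorm_ge0 //; apply/eqP.
rewrite sqr_enormB expr_div_n exprMn (sqr_enormB v w).
rewrite /inversion !dotZl ![dot _ (_ *: _)]dotC !dotZl -!sqr_enorm (dotC w v).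
by field; rewrite v0 w0.
Qed.

(** The right side is linear in the old terms of the field and of the potential. Summing over the
    charges therefore expresses the new field through the old field and potential. *)
Lemma inversion_term (v w : 'rV[R]_m) u : v != 0 -> w != 0 ->
  (u / enorm w / enorm (inversion v - inversion w) ^+ 3) *: (inversion v - inversion w) =
  enorm v ^+ 3 *: ((u / enorm (v - w) ^+ 3) *: (v - w)) +
  (enorm v * (u / enorm (v - w)
              - 2 * dot ((u / enorm (v - w) ^+ 3) *: (v - w)) v)) *: v.
Proof.
move=> v0 w0.
have [->|vw] := eqVneq v w.
  by rewrite !subrr !scaler0 enorm0 dot0l invr0 !mulr0 subrr mulr0 scale0r addr0.
have r0 : enorm (v - w) != 0 by rewrite enorm_eq0 subr_eq0.
rewrite enorm_inversion // dotZl.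
have -> : dot (v - w) v = (enorm (v - w) ^+ 2 + enorm v ^+ 2 - enorm w ^+ 2) / 2.
  by rewrite sqr_enormB !sqr_enorm dotBl (dotC w v); field.
rewrite -enorm_eq0 in v0; rewrite -enorm_eq0 in w0.
apply/rowP => k; rewrite /inversion !mxE; field.
by rewrite v0 w0 r0.
Qed.

(** Since potential and field vanish, the other charges must cancel the contribution of the one at
    the centre, whose potential and field are explicit. Inserted into [inversion_term], these values
    cancel, and the new potential is the constant [- q ord0]. *)
Lemma inversion_equilibrium n (x : 'I_n.+1 -> 'rV[R]_m) q :
  injective x ->
  (forall i, field x q i = 0) -> (forall i, potential x q i = 0) ->
  let y i := inversion (x (lift ord0 i) - x ord0) in
  let q' i := q (lift ord0 i) / enorm (x (lift ord0 i) - x ord0) in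
  [/\ injective y, forall i, field y q' i = 0 & forall i, potential y q' i = - q ord0].
Proof.
move=> xI F0 V0 y q'.
pose X i := x (lift ord0 i) - x ord0.
have X0 i : X i != 0 by rewrite subr_eq0; apply/eqP => /xI.
have e0 i : enorm (X i) != 0 by rewrite enorm_eq0.
have XB i j : X i - X j = x (lift ord0 i) - x (lift ord0 j).
  by rewrite /X opprB addrA subrK.
have VX i : \sum_j q (lift ord0 j) / enorm (X i - X j) = - (q ord0 / enorm (X i)).
  have := V0 (lift ord0 i); rewrite /potential big_ord_recl => /eqP.
  rewrite addrC addr_eq0 => /eqP <-.
  by apply: eq_bigr => j _; rewrite XB.
have FX i : \sum_j (q (lift ord0 j) / enorm (X i - X j) ^+ 3) *: (X i - X j)
    = - ((q ord0 / enorm (X i) ^+ 3) *: X i).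
  have := F0 (lift ord0 i); rewrite /field big_ord_recl => /eqP.
  rewrite addrC addr_eq0 => /eqP <-.
  by apply: eq_bigr => j _; rewrite XB.
split.
- move=> i j /eqP; rewrite -subr_eq0 -enorm_eq0 enorm_inversion ?X0 //.
  rewrite mulf_eq0 invr_eq0 mulf_eq0 !(negPf (e0 _)) !orbF enorm_eq0 XB subr_eq0.
  by move/eqP/xI/lift_inj.
- move=> i; rewrite /field /y /q'.
  under eq_bigr do rewrite inversion_term ?X0 //.
  rewrite big_split /= -scaler_sumr FX -scaler_suml -mulr_sumr sumrB VX.
  rewrite -mulr_sumr -dot_suml FX dotNl dotZl -sqr_enorm -/(X i).
  by apply/rowP => k; rewrite !mxE; field; rewrite e0.
- move=> i; rewrite /potential /y /q'.
  rewrite -[q ord0](divfK (e0 i)) -mulNr -VX mulr_suml.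
  apply: eq_bigr => j _; rewrite enorm_inversion ?X0 // -/(X j) -/(X i).
  rewrite invf_div; move: (enorm (X i - X j))^-1 => z.
  by field; rewrite e0.
Qed.

(** Two charges exert a nonzero force on each other. For five, [P = 0] is what the inversion
    requires. *)
Lemma no_equilibrium n (x : 'I_n -> 'rV[R]_m) q P :
  (1 < n <= 5)%N -> (n = 5%N -> P = 0) ->
  injective x -> (forall i, q i != 0) ->
  (forall i, field x q i = 0) -> (forall i, potential x q i = P) -> False.
Proof.
case: n x q => [|[|[|[|[|[|]]]]]] // x q _ P0 xI q0 F0 VP.
- move: (F0 ord0); rewrite /field !big_ord_recl big_ord0 subrr scaler0 add0r addr0 => /eqP.
  rewrite scaler_eq0 mulf_eq0 (negPf (q0 _)) invr_eq0 expf_eq0 enorm_eq0 /= orbb.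
  by rewrite subr_eq0 => /eqP/xI.
- exact: no_equilibrium3 xI q0 F0 VP.
- exact: no_equilibrium4 xI q0 F0 VP.
- have [yI Fy Vy] := inversion_equilibrium xI F0 (fun i => etrans (VP i) (P0 erefl)).
  apply: no_equilibrium4 yI _ Fy Vy => i.
  rewrite mulf_neq0 // invr_eq0 enorm_eq0 subr_eq0.
  by apply/eqP => /xI.
Qed.

End Static.

(** * Limits along an ultrafilter *)

Section Ultralimits.
Import numFieldNormedType.Exports.
Local Open Scope classical_set_scope.
Variables (R : realType) (T : Type) (U : set_system T).
Context {UU : UltraFilter U}.
Implicit Types f g : T -> R.

(** The image of [U] under [f] is an ultrafilter containing a compact segment, so it converges; no
    subsequence has to be extracted. *)
Lemma ultra_bounded_cvg f B :
  (\forall t \near U, `|f t| <= B) -> exists l : R, f @ U --> l.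
Proof.
move=> fB; have := @segment_compact R (- B) B; rewrite compact_ultra => /(_ (f @ U)).
case.
- split; first exact: fmap_proper_filter.
  move=> G GF UG; apply/seteqP; split=> // A GA.
  have [//|nA] := in_ultra_setVsetC (f @^-1` A) UU.
  have : G (A `&` ~` A) by apply: filterI => //; apply: UG.
  by rewrite setICr => /filter_not_empty.
- by apply: filterS fB => t; rewrite /= in_itv /= ler_norml.
- by move=> l [_ fl]; exists l.
Qed.

(** Otherwise each value is avoided on a member of [U], and the finite intersection of these members
    would be empty. *)
Lemma ultra_finite (I : finType) (h : T -> I) :
  exists i, \forall t \near U, h t = i.
Proof.
apply: contrapT => /forallNP nh.
have : \forall t \near U, forall i, h t <> i.
  apply: filter_forall => i.
  by have [/nh|] := in_ultra_setVsetC [set t | h t = i] UU.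
by case/filter_ex => t /(_ (h t)).
Qed.

Lemma near_not (P : T -> Prop) :
  ~ (\forall t \near U, P t) -> \forall t \near U, ~ P t.
Proof. by move=> nP; have [/nP|] := in_ultra_setVsetC [set t | P t] UU. Qed.

Lemma bounded_mul_cvg0 f g B : (\forall t \near U, `|f t| <= B) ->
  g @ U --> (0 : R) -> (fun t => f t * g t) @ U --> (0 : R).
Proof.
move=> /ultra_bounded_cvg[l fl] g0.
by rewrite -(mulr0 l); apply: cvgM.
Qed.

Lemma cvg_fin_sum (I : finType) (P : pred I) (F : I -> T -> R) (l : I -> R) :
  (forall i, P i -> F i @ U --> l i) ->
  (fun t => \sum_(i | P i) F i t) @ U --> \sum_(i | P i) l i.
Proof.
move=> Fl; have c : continuous (fun z : R * R => z.1 + z.2).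
  by move=> z; apply: cvgD; [exact: cvg_fst | exact: cvg_snd].
exact: (@cvg_big R I +%R 0 P c T U (index_enum I) F l _ Fl).
Qed.

Lemma cvg_enorm m (X : T -> 'rV[R]_m) (l : 'rV_m) :
  (forall k, (fun t => X t 0 k) @ U --> l 0 k) -> (fun t => enorm (X t)) @ U --> enorm l.
Proof.
move=> Xl; rewrite /enorm.
apply: (@continuous_cvg _ _ _ _ _ (fun t => \sum_k X t 0 k ^+ 2) Num.sqrt).
  exact: sqrt_continuous.
apply: cvg_fin_sum => k _.
under eq_fun do rewrite expr2.
by rewrite expr2; apply: cvgM.
Qed.

End Ultralimits.

(** * The limit of a rescaled sequence of configurations *)

Section Blowup.
Import numFieldNormedType.Exports.
Local Open Scope classical_set_scope.
Variables (R : realType) (m p : nat) (T : Type) (U : set_system T).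
Context {UU : UltraFilter U}.
Variables (X : T -> 'I_p -> 'rV[R]_m) (Q : T -> 'I_p -> R) (j : 'I_p).

Let r i k t := enorm (X t i - X t k).
Let w i k t := Q t k / r i k t.

Hypothesis r_gt0 : \forall t \near U, forall i k, i != k -> 0 < r i k t.
Hypothesis Q_le : \forall t \near U, forall i k, i != k -> `|Q t k| <= r i k t.
Hypothesis Qj : \forall t \near U, `|Q t j| = 1.
Hypothesis V0 : forall i, (fun t => potential (X t) (Q t) i) @ U --> (0 : R).
Hypothesis F0 : forall i c,
  (fun t => (Q t i *: field (X t) (Q t) i) 0 c) @ U --> (0 : R).
(** A charge [k] is active when some [w i k] does not tend to 0. The charge [j] is an active one of
    least modulus, rescaled to modulus 1. *)
Hypothesis active_ge1 : forall i k,
  ~ (w i k @ U --> (0 : R)) -> \forall t \near U, 1 <= `|Q t k|.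
Hypothesis active_j : exists i, ~ (w i j @ U --> (0 : R)).

Let rC i k t : r i k t = r k i t. Proof. exact: enormB. Qed.

Let r_ge0 i k t : 0 <= r i k t. Proof. exact: enorm_ge0. Qed.

Let r_triangle i k l t : r i l t <= r i k t + r k l t.
Proof.
rewrite /r; have -> : X t i - X t l = (X t i - X t k) + (X t k - X t l).
  by rewrite addrA subrK.
exact: ler_enormD.
Qed.

Let w_le1 i k : \forall t \near U, `|w i k t| <= 1.
Proof.
apply: filterS2 r_gt0 Q_le => t r0 Qle.
have [->|ik] := eqVneq i k.
  by rewrite /w /r subrr enorm0 invr0 mulr0 normr0.
by rewrite normf_div (ger0_norm (r_ge0 _ _ _)) ler_pdivrMr ?r0 // mul1r Qle.
Qed.

Definition clustered k := `[< exists B, \forall t \near U, r j k t <= B >].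

Lemma far_cvg k l : clustered k -> ~~ clustered l -> (fun t => (r k l t)^-1) @ U --> (0 : R).
Proof.
move=> /asboolP[B kB] /asboolPn farl; apply/cvgr0Pnorm_lt => e e0.
have /near_not farB : ~ (\forall t \near U, r j l t <= B + e^-1).
  by move=> h; apply: farl; exists (B + e^-1).
apply: filterS2 kB farB => t kB /negP; rewrite -ltNge => lB.
have rkl : e^-1 < r k l t by have := r_triangle j k l t; lra.
have r0 : 0 < r k l t by apply: lt_trans rkl; rewrite invr_gt0.
by rewrite ger0_norm ?invr_ge0 ?r_ge0 // -[e]invrK ltf_pV2 ?posrE ?invr_gt0.
Qed.

(** The difference of the two potentials is [w k l * (r j l - r k l) / r j l], whose numerator is
    bounded by the triangle inequality. The far charge itself may be unbounded. *)
Lemma far_potential k l a : clustered k -> ~~ clustered l ->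
  w j l @ U --> (a : R) -> w k l @ U --> (a : R).
Proof.
move=> ck fl wa.
have cj : clustered j.
  apply/asboolP; exists 0; apply: filterE => t.
  by rewrite /r subrr enorm0.
have jl : j != l by apply: contra fl => /eqP <-.
have kl : k != l by apply: contra fl => /eqP <-.
have D : (fun t => w k l t * (r j l t - r k l t) * (r j l t)^-1) @ U --> (0 : R).
  case/asboolP: (ck) => B kB.
  apply: (@bounded_mul_cvg0 _ _ _ _ _ _ B); last exact: far_cvg.
  apply: filterS2 (w_le1 k l) kB => t wle rle.
  rewrite normrM -[leRHS]mul1r ler_pM //.
  rewrite ler_distl; have := r_triangle j k l t; have := r_triangle k j l t.
  by rewrite (rC k j); lra.
rewrite -[a]addr0; apply: cvg_trans (cvgD wa D); apply: near_eq_cvg.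
apply: filterS r_gt0 => t r0; rewrite /= /w.
have := r0 _ _ jl; have := r0 _ _ kl => /lt0r_neq0 h1 /lt0r_neq0 h2.
by rewrite !fctE; field; rewrite h1 h2.
Qed.

(** A clustered charge is bounded by its distance to [X t j]. Far charges get limit 0 by convention,
    so that sums over all points see only the cluster. *)
Lemma limit_charge k : exists q : R,
  if clustered k then (fun t => Q t k) @ U --> q else q = 0.
Proof.
case: (boolP (clustered k)) => [/asboolP[B kB]|_]; last by exists 0.
apply: (@ultra_bounded_cvg _ _ _ _ _ (Num.max 1 B)).
apply: filterS3 kB Qj Q_le => t kB Qj1 Qle; rewrite le_max.
have [->|jk] := eqVneq k j; first by rewrite Qj1 lexx.
by rewrite (le_trans (Qle j k _) kB) ?orbT // eq_sym.
Qed.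

Lemma limit_coord (kc : 'I_p * 'I_m) : exists y, clustered kc.1 ->
  (fun t => (X t kc.1 - X t j) 0 kc.2) @ U --> (y : R).
Proof.
case: (boolP (clustered kc.1)) => [/asboolP[B kB]|]; last by exists 0.
suff [y hy] : exists y : R, (fun t => (X t kc.1 - X t j) 0 kc.2) @ U --> y by exists y.
apply: (@ultra_bounded_cvg _ _ _ _ _ B).
apply: filterS kB => t; apply: le_trans; rewrite rC; exact: ler_coord_enorm.
Qed.

(** Far charges shift all potentials in the cluster by one constant and contribute nothing to the
    forces there; colliding points carry no charge in the limit. *)
Lemma limit_configuration : exists (y : 'I_p -> 'rV[R]_m) (q : 'I_p -> R) (P : R),
  [/\ forall k, clustered k -> potential y q k = P,
      forall k, clustered k -> q k *: field y q k = 0,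
      [/\ clustered j, q j != 0, exists2 i, clustered i & y i != y j &
          forall k, ~~ clustered k -> q k = 0],
      forall k l, clustered k -> clustered l -> k != l -> y k = y l -> q l = 0 &
      (forall k, clustered k) -> P = 0].
Proof.
have [q hq'] := choice limit_charge.
have hq k : clustered k -> (fun t => Q t k) @ U --> q k.
  by move=> ck; have := hq' k; rewrite ck.
have qfar k : ~~ clustered k -> q k = 0 by move=> /negPf fk; have := hq' k; rewrite fk.
have [yy hy] := choice limit_coord.
have [P hP] := choice (fun l => ultra_bounded_cvg (w_le1 j l)).
pose y k : 'rV[R]_m := \row_c yy (k, c).
have coordE k l c : clustered k -> clustered l ->
    (fun t => (X t k - X t l) 0 c) @ U --> (y k - y l) 0 c.
  move=> ck cl; rewrite !mxE.
  apply: cvg_trans (cvgB (hy (k, c) ck) (hy (l, c) cl)).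
  by apply: near_eq_cvg; apply: filterE => t; rewrite !fctE !mxE; ring.
have rE k l : clustered k -> clustered l -> r k l @ U --> enorm (y k - y l).
  by move=> ck cl; apply: cvg_enorm => c; apply: coordE.
(* Otherwise [l] is active, and [1 <= |Q t l| <= r k l t] contradicts the collision. *)
have w0 k l : clustered k -> clustered l -> k != l -> y k = y l -> w k l @ U --> (0 : R).
  move=> ck cl kl ykl; apply: contrapT => /active_ge1 Ql.
  have := rE k l ck cl; rewrite ykl subrr enorm0 => /cvgr0_norm_lt /(_ _ ltr01) r1.
  case: (filter_ex (filterI (filterI Ql Q_le) r1)) => t [[Q1 Qr]].
  rewrite ger0_norm ?r_ge0 // => r1t.
  by have := Qr k l kl; lra.
have q0 k l : clustered k -> clustered l -> k != l -> y k = y l -> q l = 0.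
  move=> ck cl kl ykl; apply/eqP; rewrite -normr_le0 -oppr_ge0.
  have : (fun t => r k l t - `|Q t l|) @ U --> enorm (y k - y l) - `|q l|.
    by apply: cvgB; [exact: rE | exact: cvg_norm (hq l cl)].
  rewrite ykl subrr enorm0 sub0r => /cvgr_to_ge; apply.
  by apply: filterS Q_le => t /(_ k l kl); rewrite /= subr_ge0.
(* At a collision the quotient is 0 by the convention on division, in agreement with [w0]. *)
have wE k l : clustered k -> clustered l -> w k l @ U --> q l / enorm (y k - y l).
  move=> ck cl; have [<-|kl] := eqVneq k l.
    rewrite subrr enorm0 invr0 mulr0; apply: cvg_trans (@cvg_cst _ (0 : R) _ U _).
    apply: near_eq_cvg; apply: filterE => t.
    by rewrite /w /r subrr enorm0 invr0 mulr0.
  have [ykl|ykl] := eqVneq (y k) (y l).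
    by rewrite ykl subrr enorm0 invr0 mulr0; apply: w0.
  apply: cvgM; first exact: hq.
  by apply: cvgV; [rewrite enorm_eq0 subr_eq0 | apply: rE].
have cj : clustered j.
  apply/asboolP; exists 0; apply: filterE => t.
  by rewrite /r subrr enorm0.
have qj : q j != 0.
  rewrite -normr_eq0 (_ : `|q j| = 1) ?oner_eq0 //.
  apply: (@cvg_unique _ (@norm_hausdorff _ R) ((fun t => `|Q t j|) @ U)).
    by apply: cvg_norm; apply: hq.
  by apply: cvg_trans (@cvg_cst _ (1 : R) _ U _); apply: near_eq_cvg; apply: filterS Qj => t ->.
(* The common potential offsets the limits [P l] of the far contributions, and is an empty sum if no
   point is far. *)
exists y, q, (- \sum_(l | ~~ clustered l) P l); split => //.
- move=> k ck.
  have : \sum_l (if clustered l then q l / enorm (y k - y l) else P l) = 0.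
    apply: (@cvg_unique _ (@norm_hausdorff _ R) ((fun t => potential (X t) (Q t) k) @ U)); last exact: V0.
    apply: (@cvg_fin_sum _ _ _ _ _ xpredT (w k)) => l _.
    case: ifPn => cl; first exact: wE.
    by apply: far_potential => //; apply: hP.
  rewrite (bigID clustered) /= addrC => /eqP; rewrite addr_eq0 => /eqP E.
  rewrite (eq_bigr P) in E; last by move=> l /negPf ->.
  rewrite E opprK /potential [LHS](bigID clustered) /= [X in _ + X]big1 ?addr0; last first.
    by move=> l /qfar ->; rewrite mul0r.
  by apply: eq_bigr => l ->.
- move=> k ck; apply/rowP => c; rewrite [RHS]mxE.
  (* Each term of the force is a product of two terms of potentials and a coordinate of a unit
     vector. All factors are bounded, so it vanishes in the limit as soon as one factor does. *)
  have FE (x : 'I_p -> 'rV[R]_m) (u : 'I_p -> R) : (u k *: field x u k) 0 c =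
      \sum_l (u l / enorm (x k - x l)) * (u k / enorm (x l - x k)) *
             ((x k - x l) 0 c / enorm (x k - x l)).
    rewrite mxE summxE mulr_sumr; apply: eq_bigr => l _.
    by rewrite mxE (enormB (x l)) -exprVn; ring.
  have := F0 k c; under eq_fun do rewrite FE.
  apply: (@cvg_unique _ (@norm_hausdorff _ R)).
  rewrite FE; apply: cvg_fin_sum => l _.
  have unit_le1 : \forall t \near U, `|(X t k - X t l) 0 c / r k l t| <= 1.
    apply: filterE => t; have [r0|r0] := eqVneq (r k l t) 0.
      by rewrite r0 invr0 mulr0 normr0.
    rewrite normf_div (ger0_norm (r_ge0 _ _ _)) ler_pdivrMr ?lt_def ?r0 ?r_ge0 //.
    by rewrite mul1r; exact: ler_coord_enorm.
  have vanish a b : (\forall t \near U, `|a t| <= 1) -> b @ U --> (0 : R) ->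
      (fun t => a t * b t * ((X t k - X t l) 0 c / r k l t)) @ U --> (0 : R).
    move=> a1 b0; under eq_fun do rewrite mulrC.
    exact: bounded_mul_cvg0 unit_le1 (bounded_mul_cvg0 a1 b0).
  have [cl|fl] := boolP (clustered l); last first.
    rewrite (qfar l) // !mul0r; apply: (vanish (w k l)); first exact: w_le1.
    rewrite -(mulr0 (q k)); apply: cvgM; first exact: hq.
    under eq_fun do rewrite -/(r l k _) rC.
    exact: far_cvg.
  have [ykl|ykl] := eqVneq (y k) (y l).
    rewrite ykl subrr enorm0 invr0 !mulr0.
    have [->|kl] := eqVneq k l.
      under eq_fun do rewrite subrr mxE mul0r mulr0.
      exact: cvg_cst.
    under eq_fun do rewrite [X in X * _]mulrC.
    apply: (vanish (w l k)); first exact: w_le1.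
    exact: w0.
  apply: cvgM; first by apply: cvgM; apply: wE.
  apply: cvgM; first exact: coordE.
  by apply: cvgV; [rewrite enorm_eq0 subr_eq0 | apply: rE].
- split => //; have [i ni] := active_j.
  have ci : clustered i.
    apply: contrapT => /negP fi; apply: ni.
    rewrite -[0](mulr0 (q j)); apply: cvgM; first exact: hq.
    under eq_fun do rewrite rC.
    exact: far_cvg.
  have ij : i != j.
    apply/eqP => ij; apply: ni; rewrite ij.
    apply: cvg_trans (@cvg_cst _ (0 : R) _ U _).
    apply: near_eq_cvg; apply: filterE => t.
    by rewrite /w /r subrr enorm0 invr0 mulr0.
  by exists i => //; apply/eqP => yij; apply: ni; apply: w0.
- by move=> ca; rewrite big1 ?oppr0 // => l; rewrite ca.
Qed.

End Blowup.

(** * Exclusion of the limit configuration; scale invariance *)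

Section Limit.
Variables (R : realType) (m p : nat).

Lemma sum_support (V : nmodType) (q : 'I_p -> R) (F : 'I_p -> V) :
  (forall l, q l = 0 -> F l = 0) ->
  \sum_l F l = \sum_(a < #|[set l | q l != 0]|) F (enum_val a).
Proof.
move=> F0; rewrite -big_enum_val /= [LHS](bigID (mem [set l | q l != 0])) /=.
rewrite [X in _ + X]big1 ?addr0 // => l.
by rewrite inE negbK => /eqP/F0.
Qed.

(** The charged points are distinct and in equilibrium. A lone charge at [y j] would produce
    potential 0 at [y j] by convention but a nonzero one at [y i]. Five charged points exhaust all
    points, so all are clustered and [P = 0]. *)
Lemma no_limit_configuration (y : 'I_p -> 'rV[R]_m) q P (clustered : pred 'I_p) i j :
  (p <= 5)%N ->
  (forall k, clustered k -> potential y q k = P) ->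
  (forall k, clustered k -> q k *: field y q k = 0) ->
  (forall k, ~~ clustered k -> q k = 0) ->
  (forall k l, clustered k -> clustered l -> k != l -> y k = y l -> q l = 0) ->
  ((forall k, clustered k) -> P = 0) ->
  clustered j -> q j != 0 -> clustered i -> y i != y j -> False.
Proof.
move=> p5 VP F0 qfar q0 P0 cj qj ci yij.
set S := [set l | q l != 0].
have jS : j \in S by rewrite inE.
have cS k : k \in S -> clustered k by rewrite inE; apply: contraR => /qfar ->.
have VS k : potential y q k = \sum_(a < #|S|) q (enum_val a) / enorm (y k - y (enum_val a)).
  by apply: sum_support => l ->; rewrite mul0r.
have S5 : (#|S| <= 5)%N by apply: leq_trans (max_card _) _; rewrite card_ord.
have [S1|S1] := leqP #|S| 1.
  have SE : S = [set j].
    by apply/esym/eqP; rewrite eqEcard finset.sub1set jS cards1.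
  have V1 k : potential y q k = q j / enorm (y k - y j).
    rewrite /potential (bigD1 j) //= big1 ?addr0 // => l lj.
    by have : l \notin S by [rewrite SE inE]; rewrite inE negbK => /eqP ->; rewrite mul0r.
  have := VP j cj; rewrite -(VP i ci) !V1 subrr enorm0 invr0 mulr0 => /esym/eqP.
  by rewrite mulf_eq0 (negPf qj) invr_eq0 enorm_eq0 subr_eq0 (negPf yij).
apply: (@no_equilibrium R m #|S| (fun a => y (enum_val a)) (fun a => q (enum_val a)) P).
- by rewrite S1.
- move=> Sn; apply: P0 => k; apply: cS.
  suff -> : S = [set: 'I_p] by rewrite inE.
  by apply/eqP; rewrite eqEcard finset.subsetT cardsT card_ord Sn.
- move=> a b yab; apply: enum_val_inj; apply/eqP; apply: contraT => ab.
  have := q0 _ _ (cS _ (enum_valP a)) (cS _ (enum_valP b)) ab yab.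
  by have := enum_valP b; rewrite inE => /eqP.
- by move=> a; have := enum_valP a; rewrite inE.
- move=> a; have aS := enum_valP a.
  have /eqP := F0 _ (cS _ aS); rewrite scaler_eq0; rewrite inE in aS.
  rewrite (negPf aS) /= => /eqP <-.
  by rewrite /field (@sum_support _ q) // => l ->; rewrite mul0r scale0r.
- by move=> a; rewrite [LHS]/potential -VS; apply: VP; apply: cS; apply: enum_valP.
Qed.

Lemma enorm_scaleB c (v w : 'rV[R]_m) :
  enorm (c *: v - c *: w) = `|c| * enorm (v - w).
Proof. by rewrite -scalerBr enormZ. Qed.

Lemma potential_scale n (x : 'I_n -> 'rV[R]_m) u c i : 0 < c ->
  potential (fun k => c *: x k) (fun k => c * u k) i = potential x u i.
Proof.
move=> c0; apply: eq_bigr => k _.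
by rewrite enorm_scaleB gtr0_norm // -mulf_div divff ?mul1r // gt_eqF.
Qed.

Lemma force_scale n (x : 'I_n -> 'rV[R]_m) u c i : 0 < c ->
  (c * u i) *: field (fun k => c *: x k) (fun k => c * u k) i = u i *: field x u i.
Proof.
move=> c0; rewrite !scaler_sumr; apply: eq_bigr => k _.
rewrite enorm_scaleB gtr0_norm // -scalerBr !scalerA; congr (_ *: _).
rewrite -!exprVn invfM; move: (enorm _)^-1 => r; field.
by rewrite gt_eqF.
Qed.

End Limit.

(** * A uniform lower bound by compactness *)

Section Compactness.
Import numFieldNormedType.Exports.
Local Open Scope classical_set_scope.
Variables (R : realType) (m p : nat).

(** There are finitely many indices, so the pair attaining the normalisation and the least active
    charge are each constant along [U]; the first provides an active charge. *)
Lemma no_vanishing_sequence (T : Type) (U : set_system T) (UU : UltraFilter U)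
    (x : T -> 'I_p -> 'rV[R]_m) (u : T -> 'I_p -> R) :
  (p <= 5)%N ->
  (forall t, injective (x t)) ->
  (forall t i k, i != k -> `|u t k| <= enorm (x t i - x t k)) ->
  (forall t, exists ik : 'I_p * 'I_p,
     ik.1 != ik.2 /\ `|u t ik.2| = enorm (x t ik.1 - x t ik.2)) ->
  (forall i, (fun t => potential (x t) (u t) i) @ U --> (0 : R)) ->
  (forall i c, (fun t => (u t i *: field (x t) (u t) i) 0 c) @ U --> (0 : R)) ->
  False.
Proof.
move=> p5 xI uM uE V0 F0.
have r0 t i k : i != k -> 0 < enorm (x t i - x t k).
  by move=> ik; rewrite enorm_gt0 subr_eq0; apply: contra_neq ik => /xI.
pose w i k t := u t k / enorm (x t i - x t k).
have [h hE] := choice uE.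
have [[i0 j0] /= hij] := ultra_finite h.
have [t0 ht0] := filter_ex hij.
have ij0 : i0 != j0 by have [] := hE t0; rewrite ht0.
have active_j0 : ~ (w i0 j0 @ U --> (0 : R)).
  move=> /cvgr0_norm_lt /(_ _ ltr01) w1.
  case: (filter_ex (filterI w1 hij)) => t [] /[swap] ht.
  have [_] := hE t; rewrite ht /= /w normf_div => ->.
  by rewrite ger0_norm ?enorm_ge0 // divff ?ltxx // gt_eqF // r0.
pose active k := `[< exists i, ~ (w i k @ U --> (0 : R)) >].
have aj0 : active j0 by apply/asboolP; exists i0.
pose g t := [arg min_(k < j0 | active k) `|u t k|]%O.
have gP t : active (g t) /\ forall k, active k -> `|u t (g t)| <= `|u t k|.
  by rewrite /g; case: Order.TotalTheory.arg_minP.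
have [j hj] := ultra_finite g.
have aj : active j by have [t <-] := filter_ex hj; have [] := gP t.
have [i wij] := asboolW aj.
(* The scaling factor is nonzero along [U], since a charge vanishing there would be inactive. *)
have uj0 : \forall t \near U, 0 < `|u t j|.
  apply: filterS (near_not (_ : ~ \forall t \near U, u t j = 0)).
    by move=> t /eqP; rewrite normr_gt0.
  move=> u0; apply: wij.
  apply: cvg_trans (@cvg_cst _ (0 : R) _ U _); apply: near_eq_cvg.
  by apply: filterS u0 => t; rewrite /w => ->; rewrite mul0r.
pose X t k := `|u t j|^-1 *: x t k.
pose Q t k := `|u t j|^-1 * u t k.
pose W i k t := Q t k / enorm (X t i - X t k).
have wW a k : ~ (W a k @ U --> (0 : R)) <-> ~ (w a k @ U --> (0 : R)).
  have E : \forall t \near U, W a k t = w a k t.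
    apply: filterS uj0 => t s0.
    rewrite /W /Q /X enorm_scaleB [`|_^-1|]gtr0_norm ?invr_gt0 // -mulf_div divff ?mul1r //.
    by rewrite invr_eq0 gt_eqF.
  split=> n c; apply: n; apply: cvg_trans c; apply: near_eq_cvg; move: E; apply: filterS => t //.
have V0' a : (fun t => potential (X t) (Q t) a) @ U --> (0 : R).
  apply: cvg_trans (V0 a); apply: near_eq_cvg; apply: filterS uj0 => t s0.
  by rewrite potential_scale ?invr_gt0.
have F0' a c : (fun t => (Q t a *: field (X t) (Q t) a) 0 c) @ U --> (0 : R).
  apply: cvg_trans (F0 a c); apply: near_eq_cvg; apply: filterS uj0 => t s0.
  by rewrite force_scale ?invr_gt0.
have XE t a b : 0 < `|u t j| ->
    enorm (X t a - X t b) = `|u t j|^-1 * enorm (x t a - x t b).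
  by move=> s0; rewrite enorm_scaleB ger0_norm // invr_ge0 ltW.
have QE t a : 0 < `|u t j| -> `|Q t a| = `|u t j|^-1 * `|u t a|.
  by move=> s0; rewrite normrM ger0_norm // invr_ge0 ltW.
have X_gt0 : \forall t \near U, forall a b, a != b -> 0 < enorm (X t a - X t b).
  by apply: filterS uj0 => t s0 a b ab; rewrite XE // mulr_gt0 ?invr_gt0 ?r0.
have Q_le : \forall t \near U, forall a b, a != b -> `|Q t b| <= enorm (X t a - X t b).
  by apply: filterS uj0 => t s0 a b ab; rewrite XE // QE // ler_wpM2l ?uM // invr_ge0 ltW.
have Qj : \forall t \near U, `|Q t j| = 1.
  by apply: filterS uj0 => t s0; rewrite QE // mulVf // gt_eqF.
have act_ge1 a b : ~ (W a b @ U --> (0 : R)) -> \forall t \near U, 1 <= `|Q t b|.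
  move=> /wW wab; apply: filterS2 uj0 hj => t s0 gt.
  have ab : active b by apply/asboolP; exists a.
  by rewrite QE // ler_pdivlMl // mulr1 -{1}gt; apply: (gP t).2.
have act_j : exists a, ~ (W a j @ U --> (0 : R)) by exists i; apply/wW.
have [y [q [P [VP FP [cj qj [k ck yk] qfar] q0 P0]]]] :=
  limit_configuration X_gt0 Q_le Qj V0' F0' act_ge1 act_j.
exact: (no_limit_configuration p5 VP FP qfar q0 P0 cj qj ck yk).
Qed.

Lemma normalized_lower_bound : (p <= 5)%N -> exists2 e : R, 0 < e &
  forall (x : 'I_p -> 'rV[R]_m) (u : 'I_p -> R), injective x ->
  (forall i k, i != k -> `|u k| <= enorm (x i - x k)) ->
  (exists ik : 'I_p * 'I_p, ik.1 != ik.2 /\ `|u ik.2| = enorm (x ik.1 - x ik.2)) ->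
  (exists i, e <= `|potential x u i|) \/ (exists i, e <= enorm (u i *: field x u i)).
Proof.
move=> p5; apply: contrapT => /forall2NP bad.
have {}bad (n : nat) : exists xu : ('I_p -> 'rV[R]_m) * ('I_p -> R),
    [/\ injective xu.1,
      forall i k, i != k -> `|xu.2 k| <= enorm (xu.1 i - xu.1 k),
      exists ik : 'I_p * 'I_p, ik.1 != ik.2 /\ `|xu.2 ik.2| = enorm (xu.1 ik.1 - xu.1 ik.2),
      forall i, `|potential xu.1 xu.2 i| < n.+1%:R^-1 &
      forall i, enorm (xu.2 i *: field xu.1 xu.2 i) < n.+1%:R^-1].
  have [/negP|] := bad n.+1%:R^-1; first by rewrite invr_gt0 ltr0n.
  move=> /existsNP[x] /existsNP[u] /not_implyP[xI] /not_implyP[uM] /not_implyP[uE].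
  move=> /not_orP[/forallNP nV /forallNP nF].
  exists (x, u); split=> // i; rewrite ltNge; apply/negP; [exact: nV | exact: nF].
have [c cP] := choice bad.
(* An ultrafilter finer than the filter at infinity keeps the limits of sequences. *)
have [U [UU oU]] := ultraFilterLemma eventually_filter.
have small (f : nat -> R) : (forall n, `|f n| < n.+1%:R^-1) -> f @ U --> (0 : R).
  move=> fn; apply/cvgr0Pnorm_lt => e e0; apply: oU.
  have := near_infty_natSinv_lt (PosNum e0).
  by apply: filterS => n; apply: lt_trans.
apply: (@no_vanishing_sequence nat U UU (fun n => (c n).1) (fun n => (c n).2)) => //.
- by move=> n; have [] := cP n.
- by move=> n; have [] := cP n.
- by move=> n; have [] := cP n.
- by move=> i; apply: small => n; have [] := cP n.
- move=> i k; apply: small => n; have [_ _ _ _ /(_ i)] := cP n.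
  exact: le_lt_trans (ler_coord_enorm _ _).
Qed.

End Compactness.

(** * The inequality, by homogeneity in the charges *)

Lemma potentialE (R : realType) (m n : nat) (x : 'I_n -> 'rV[R]_m) u i :
  \sum_(j < n | j != i) u j / enorm (x i - x j) = potential x u i.
Proof. by rewrite /potential [RHS](bigD1 i) //= subrr enorm0 invr0 mulr0 add0r. Qed.

Lemma forceE (R : realType) (m n : nat) (x : 'I_n -> 'rV[R]_m) u i :
  \sum_(j < n | j != i) (u i * u j / enorm (x i - x j) ^+ 3) *: (x i - x j)
  = u i *: field x u i.
Proof. by rewrite scale_field [RHS](bigD1 i) //= weight_diag scale0r add0r. Qed.

Theorem theorem3p3 (R : realType) (p m : nat)
    (hp : p = 4%N \/ p = 5%N) (hm : (1 <= m)%N) :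
  exists2 c : R, 0 < c &
    forall (x : 'I_p -> 'rV[R]_m) (u : 'I_p -> R),
      injective x ->
      \sum_(i < p) `|\sum_(j < p | j != i) u j / enorm (x i - x j)| ^+ 2
      + 2 * \big[Num.max/0]_(i < p)
              enorm (\sum_(j < p | j != i)
                       (u i * u j / enorm (x i - x j) ^+ 3) *: (x i - x j))
      >= c * \sum_(i < p) \sum_(j < p | j != i)
               (u j ^+ 2 / enorm (x i - x j) ^+ 2).
Proof.
have p5 : (p <= 5)%N by case: hp => ->.
have p1 : (1 < p)%N by case: hp => ->.
have [e e0 He] := @normalized_lower_bound R m p p5.
have pp0 : 0 < (p * p)%:R :> R by rewrite ltr0n muln_gt0 (ltnW p1).
(* With [M] the largest ratio, the bound [e] on a potential yields [e ^+ 2 * M ^+ 2] on the left,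
   and on a force [2 * e * M ^+ 2]. The right side has at most [p * p] terms, each at most
   [M ^+ 2]. *)
pose d := Num.min (e ^+ 2) (2 * e).
have d0 : 0 < d by rewrite lt_min exprn_gt0 // mulr_gt0.
exists (d / (p * p)%:R); first by rewrite divr_gt0.
move=> x u xI.
under [X in _ <= X + _]eq_bigr do rewrite potentialE.
under [X in _ <= _ + 2 * X]eq_bigr do rewrite forceE.
set LHS := (X in _ <= X).
have r0 i j : i != j -> 0 < enorm (x i - x j).
  by move=> ij; rewrite enorm_gt0 subr_eq0; apply: contra_neq ij => /xI.
pose wt (ij : 'I_p * 'I_p) := `|u ij.2| / enorm (x ij.1 - x ij.2).
pose ij0 := (Ordinal (ltnW p1), Ordinal p1).
have ij0P : ij0.1 != ij0.2 by [].
have [[i j] /= ij ijmax] := @Order.TotalTheory.arg_maxP _ R _ ij0 (fun ij => ij.1 != ij.2) wt ij0P.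
set M := wt (i, j) in ijmax.
have M_ge0 : 0 <= M by rewrite divr_ge0 ?enorm_ge0.
have V_le k : `|potential x u k| ^+ 2 <= LHS.
  rewrite /LHS (bigD1 k) //= -addrA lerDl addr_ge0 ?sumr_ge0 //.
  by rewrite mulr_ge0 // bigmax_ge_id.
have F_le k : 2 * enorm (u k *: field x u k) <= LHS.
  rewrite /LHS -[leLHS]add0r lerD ?sumr_ge0 //.
  by rewrite ler_pM2l // (le_bigmax _ (fun k => enorm (u k *: field x u k))).
have RHS_le : \sum_(i < p) \sum_(j < p | j != i) (u j ^+ 2 / enorm (x i - x j) ^+ 2)
    <= M ^+ 2 * (p * p)%:R.
  apply: (@le_trans _ _ (\sum_(i < p) \sum_(j < p) M ^+ 2)).
    apply: ler_sum => k _; rewrite [leRHS](bigID (fun l => l != k)) /=.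
    rewrite -[leLHS]addr0 lerD ?sumr_ge0 // => [|l _]; last exact: exprn_ge0.
    apply: ler_sum => l lk; have := ijmax (k, l).
    rewrite /= eq_sym lk => /(_ isT) wM.
    rewrite -[u l ^+ 2]real_normK ?num_real // -expr_div_n ler_pXn2r ?nnegrE //.
    by rewrite divr_ge0 ?enorm_ge0.
  by rewrite !sumr_const card_ord -mulrnA mulr_natr.
rewrite mulrAC ler_pdivrMr //.
apply: le_trans (ler_wpM2l (ltW d0) RHS_le) _.
rewrite mulrA ler_pM2r //.
have [M0|M_neq0] := eqVneq M 0.
  rewrite M0 expr0n mulr0; apply: le_trans (V_le i); exact: exprn_ge0.
have M_gt0 : 0 < M by rewrite lt_def M_neq0.
have VM k : potential x (fun l => M^-1 * u l) k = M^-1 * potential x u k.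
  by rewrite mulr_sumr; apply: eq_bigr => l _; rewrite mulrA.
have FM k : (M^-1 * u k) *: field x (fun l => M^-1 * u l) k = M ^- 2 *: (u k *: field x u k).
  rewrite !scaler_sumr; apply: eq_bigr => l _; rewrite !scalerA; congr (_ *: _).
  by rewrite -!exprVn; ring.
(* Dividing the charges by [M] normalises the largest ratio to 1; potentials scale by [M^-1] and
   forces by [M ^- 2]. *)
case: (He x (fun l => M^-1 * u l) xI).
- move=> k l kl; rewrite normrM ger0_norm ?invr_ge0 // ler_pdivrMl //.
  by have := ijmax (k, l) kl; rewrite /wt /= ler_pdivrMr ?r0.
- exists (i, j); split=> //=; rewrite normrM ger0_norm ?invr_ge0 //.
  apply: (mulfI M_neq0); rewrite mulVKf // /M /wt /= divfK // gt_eqF // r0 //.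
- case=> k; rewrite VM normrM ger0_norm ?invr_ge0 // ler_pdivlMl // => eV.
  apply: le_trans (V_le k); apply: (@le_trans _ _ (e ^+ 2 * M ^+ 2)).
    by rewrite ler_wpM2r ?exprn_ge0 // /d ge_min lexx.
  by rewrite -exprMn mulrC ler_pXn2r ?nnegrE ?(mulr_ge0 M_ge0 (ltW e0)).
- case=> k; rewrite FM enormZ ger0_norm ?invr_ge0 ?exprn_ge0 // ler_pdivlMl ?exprn_gt0 // => eF.
  apply: le_trans (F_le k); apply: (@le_trans _ _ (2 * e * M ^+ 2)).
    by rewrite ler_wpM2r ?exprn_ge0 // /d ge_min lexx orbT.
  by rewrite -mulrA ler_pM2l // mulrC.
Qed.
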